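(* Let $k\ge1$ and $d\ge1$ be integers. The competitive ratio of DoubleCoverage for the $k$-taxi problem on unweighted tree metrics of combinatorial depth $d$ is at least $$4\sum_{h=1}^{d-1}\binom{k+h-2}{h}+2\binom{k+d-2}{d}+1.$$
   Context: The $k$-taxi problem: given a metric space, $k$ servers start at given points; requests $(s_t,d_t)$ arrive online; to serve one, an algorithm moves some server to $s_t$ (if none is there), paying the distance traveled, and then relocates a server at $s_t$ to $d_t$ at no cost; the cost is the total distance traveled excluding relocations. ALG is $c$-competitive on a class of metrics if for each metric and initial configuration there is a constant $a$ with $\mathrm{ALG}(\sigma)\le c\,\mathrm{OPT}(\sigma)+a$ for all $\sigma$; its competitive ratio on the class is at least $c$ if it is not $c'$-competitive for any $c'<c$. An unweighted tree metric is a tree with all edge weights $1$, points = vertices. Combinatorial depth $d$: for some root, every vertex is at most $d$ edges from the root. DoubleCoverage (DC): to bring a server to requested vertex $s$, all unobstructed servers (no other server on their path to $s$; among co-located servers only one counts) move toward $s$ at equal speed until one reaches $s$, a server becoming obstructed stops; then a server is relocated from $s_t$ to $d_t$. *)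

(* Defs.v *)
From mathcomp Require Import all_boot all_order all_algebra.
From mathcomp Require Import classical_sets reals.

Set Implicit Arguments.
Unset Strict Implicit.
Unset Printing Implicit Defensive.

Import Order.TTheory GRing.Theory Num.Theory.
Local Open Scope ring_scope.

Section Graph.
Variables (V : finType) (e : rel V).

Definition is_tree : Prop :=
  [/\ symmetric e, irreflexive e, forall x y, connect e x y &
      forall p : seq V, ucycle e p -> (size p < 3)%N].

(* Length of a shortest path; [#|V|] (the size of the list searched) when there
   is no path, which does not happen in a tree. *)
Definition gdist (x y : V) : nat :=
  find (fun n => [exists p : n.-tuple V, path e x p && (last x p == y)])
       (iota 0 #|V|).

Definition has_depth (d : nat) : Prop :=
  exists r : V, forall v : V, (gdist r v <= d)%N.

End Graph.

Section Taxi.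
Variables (R : realType) (V : finType) (e : rel V) (k : nat).

Definition config := {ffun 'I_k -> V}.

Definition request := (V * V)%type.

Definition relocate (C : config) (i : 'I_k) (y : V) : config :=
  [ffun j => if j == i then y else C j].

(* [move s C C' v]: when [s] is requested in [C], the servers may move to [C'],
   travelling the total distance [v].
   [run move C sigma v]: serving [sigma] from [C] may cost [v]. *)
Inductive run (move : V -> config -> config -> R -> Prop) :
    config -> seq request -> R -> Prop :=
| run_nil C : run move C [::] 0
| run_cons C s y sigma C' v i w :
    move s C C' v -> C' i = s -> run move (relocate C' i y) sigma w ->
    run move C ((s, y) :: sigma) (v + w).

Definition any_move (s : V) (C C' : config) (v : R) : Prop :=
  v = (\sum_(i < k) gdist e (C i) (C' i))%:R.

Definition opt (C : config) (sigma : seq request) : R :=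
  inf [set v | run any_move C sigma v]%classic.

(* The neighbour of [u] on the path to [s]; [s] itself if [u = s]. *)
Definition next (s u : V) : V :=
  odflt u [pick v | e u v && (gdist e v s < gdist e u s)%N].

(* Points of the tree, edges included, are relative to a target vertex [s]:
   [(u, x)] with [0 <= x < 1] is the point at distance [x] from [u] on the
   edge from [u] to [next s u]. *)
Definition point := (V * R)%type.

Definition advance (s u : V) (m : R) : point :=
  (iter (Num.truncn m) (next s) u, m - (Num.truncn m)%:R).

(* [q] lies on the path from [p] to [s]. *)
Definition on_path (s : V) (p q : point) : bool :=
  if q.1 == p.1 then p.2 <= q.2
  else (gdist e p.1 q.1 + gdist e q.1 s == gdist e p.1 s)%N.

(* Of several servers at the same point, the one of least index counts. *)
Definition obstructed (s : V) (P : 'I_k -> point) (i : 'I_k) : bool :=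
  [exists j, on_path s (P i) (P j) && ((P j != P i) || (j < i)%N)].

(* The servers move during the time interval [0, T]. An obstructed server never
   becomes unobstructed, so server [i] moves at unit speed up to some time
   [tau i] and then stands still; [P t] gives the positions at time [t].
   Since servers start at vertices and edges have length 1, they end at
   vertices. *)
Definition dc_move (s : V) (C C' : config) (v : R) : Prop :=
  exists (T : R) (tau : 'I_k -> R),
    let P (t : R) (i : 'I_k) := advance s (C i) (Num.min t (tau i)) in
    [/\ 0 <= T /\ (forall i, 0 <= tau i <= T),
        (exists i, P T i = (s, 0)) /\
          (forall t i, 0 <= t < T -> P t i <> (s, 0)),
        forall t i, 0 <= t < T -> (obstructed s (P t) i <-> tau i <= t),
        forall i, P T i = (C' i, 0)
      & v = \sum_(i < k) tau i].

Definition double_coverage : config -> seq request -> R -> Prop := run dc_move.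

End Taxi.

Section Competitive.
Variables (R : realType) (k : nat).

Definition metric_class := forall V : finType, rel V -> Prop.

Definition algorithm :=
  forall (V : finType) (e : rel V), config V k -> seq (request V) -> R -> Prop.

Definition competitive (cls : metric_class) (alg : algorithm) (c : R) : Prop :=
  forall (V : finType) (e : rel V), cls V e ->
  forall C : config V k, exists a : R,
  forall (sigma : seq (request V)) (v : R),
    alg V e C sigma v -> v <= c * opt R e C sigma + a.

Definition ratio_at_least (cls : metric_class) (alg : algorithm) (c : R) :
    Prop :=
  forall c' : R, c' < c -> ~ competitive cls alg c'.

End Competitive.

Definition tree_metrics (d : nat) : metric_class :=
  fun V e => is_tree e /\ has_depth e d.

(* Main.v *)
(* Write [D] and [O] for the multisets of server positions of double coverage
   and of an offline algorithm. A server common to both can be relocated anywhere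
   for free, by a request at its position; a request at a point of [O] is free
   offline. Moreover, if all neighbours of [s] that matter carry servers of [D],
   a request at [s] makes each of them advance by one, so that they pile up at
   [s], away from the positions of [O].

   In the complete [k]-ary tree of depth [d], start with [D] = [O] = [k] neighbours
   of a vertex at depth [d - 1] and let the offline algorithm move one server
   by one step to that vertex, at cost 1. The discrepancy is then carried
   through the tree without further offline cost, up to the root and down into
   its branches. If [j] servers of [D] are at [u], [O] has [j] children of
   [u] instead, and [q] servers are common, then with [h] the height of [u] and
   [m = j + q - 1] resolving this costs double coverage
   [2 C(m+h,h) - m - 2 C(q-1+h,h) + q - 1], by Pascal's rule. Adding up the
   levels gives the constant of the theorem, after which [D] = [O] and the phase
   can be repeated. *)

Require Import Defs.
From mathcomp Require Import all_boot all_order all_algebra.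
From mathcomp Require Import classical_sets reals.
From mathcomp Require Import zify ring.

Set Implicit Arguments.
Unset Strict Implicit.
Unset Printing Implicit Defensive.

Import Order.TTheory GRing.Theory Num.Theory.
Local Open Scope ring_scope.

(** * Shortest-path distance in a connected graph *)

Section Distance.
Variables (V : finType) (e : rel V).

Lemma gdist_path x (p : seq V) : path e x p -> (gdist e x (last x p) <= size p)%N.
Proof.
move=> xp; rewrite leqNgt; apply/negP => lt_p.
have p_small : (size p < #|V|)%N.
  by apply: leq_trans lt_p _; rewrite -[X in (_ <= X)%N](size_iota 0) find_size.
have := before_find 0%N lt_p; rewrite nth_iota // add0n // => /= /negbT/negP; apply.
by apply/existsP; exists (in_tuple p); rewrite xp eqxx.
Qed.

(** A path without repetitions has fewer than [#|V|] edges, so the bounded search in [gdist]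
    succeeds. *)
Lemma gdist_attained x y : connect e x y ->
  exists p : seq V, [/\ path e x p, last x p = y & size p = gdist e x y].
Proof.
move=> /connectP[p xp ->].
case: (shortenP xp) => q xq q_uniq _.
have q_small : (size q < #|V|)%N.
  by rewrite -[(size q).+1]/(size (x :: q)) -(card_uniqP q_uniq) max_card.
set P := fun n => [exists t : n.-tuple V, path e x t && (last x t == last x q)].
have hasP : has P (iota 0 #|V|).
  apply/hasP; exists (size q); first by rewrite mem_iota.
  by apply/existsP; exists (in_tuple q); rewrite xq eqxx.
have := nth_find 0%N hasP; rewrite nth_iota ?add0n; last first.
  by rewrite -[X in (_ < X)%N](size_iota 0) -has_find.
by case/existsP=> t /andP[xt /eqP xt_last]; exists t; rewrite size_tuple.
Qed.

Lemma gdistxx x : gdist e x x = 0%N.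
Proof. by have := @gdist_path x [::] isT; rewrite leqn0 => /eqP. Qed.

Hypotheses (e_irr : irreflexive e) (e_conn : forall x y, connect e x y).

Lemma gdist_eq0 x y : (gdist e x y == 0%N) = (x == y).
Proof.
apply/eqP/eqP => [d0|->]; last exact: gdistxx.
by have [p [_ py]] := gdist_attained (e_conn x y); rewrite d0 -py => /size0nil ->.
Qed.

Lemma gdist_edge x y : e x y -> gdist e x y = 1%N.
Proof.
move=> exy; apply/eqP; rewrite eqn_leq lt0n gdist_eq0.
have := @gdist_path x [:: y]; rewrite /= exy => /(_ isT) ->.
by apply: contraTneq exy => ->; rewrite e_irr.
Qed.

Lemma gdist_rcons x y z : e y z -> (gdist e x z <= (gdist e x y).+1)%N.
Proof.
move=> eyz; have [p [xp py <-]] := gdist_attained (e_conn x y).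
have := @gdist_path x (rcons p z); rewrite rcons_path last_rcons size_rcons xp py.
exact.
Qed.

Lemma next_edge s u : e u s -> Defs.next e s u = s.
Proof.
move=> eus; rewrite /Defs.next; case: pickP => [v /andP[_]|/(_ s)].
  by rewrite (gdist_edge eus) ltnS leqn0 gdist_eq0 => /eqP.
by rewrite eus gdistxx (gdist_edge eus).
Qed.

End Distance.

(** * Single moves of double coverage in which every server travels zero or one edge *)

Section Moves.
Variables (R : realType) (V : finType) (e : rel V) (k : nat).
Hypotheses (e_irr : irreflexive e) (e_conn : forall x y, connect e x y).
Implicit Types C : config V k.

Lemma advance_stay s u (m : R) : 0 <= m < 1 -> advance e s u m = (u, m).
Proof.
move=> /andP[m0 m1]; rewrite /advance.
have -> : Num.truncn m = 0%N by apply: truncn_def; rewrite m0 m1.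
by rewrite /= subr0.
Qed.

Lemma advance_edge s u : e u s -> advance e s u 1 = (s, 0 : R).
Proof.
by move=> eus; rewrite /advance truncn1 /= subrr next_edge.
Qed.

Lemma dc_move_occupied s C i : C i = s -> dc_move e s C C (0 : R).
Proof.
move=> Cis; exists 0, (fun=> 0) => P.
have P0 t j : 0 <= t -> P t j = (C j, 0).
  by move=> t0; rewrite /P min_r // advance_stay // lexx ltr01.
split=> [|||j|]; first by split=> // j; rewrite lexx.
- split; first by exists i; rewrite P0 // Cis.
  by move=> t j /andP[t0 /(le_lt_trans t0)]; rewrite ltxx.
- by move=> t j /andP[t0 /(le_lt_trans t0)]; rewrite ltxx.
- exact: P0.
- by rewrite big1.
Qed.

Lemma dc_move_star s C (M : {set 'I_k}) (i0 : 'I_k) : i0 \in M ->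
    (forall i, i \in M -> e (C i) s) -> {in M &, injective C} ->
    (forall i, i \notin M -> C i <> s /\ exists2 j, j \in M &
       (C j == C i) && (j < i)%N || (C j != C i) &&
       (gdist e (C i) (C j) + gdist e (C j) s == gdist e (C i) s)%N) ->
  dc_move e s C [ffun i => if i \in M then s else C i] (#|M|%:R : R).
Proof.
move=> i0M Me Minj Mblock; exists 1, (fun i => (i \in M)%:R) => P.
have Ces i : C i <> s.
  case: (boolP (i \in M)) => [/Me e_is Cis|/Mblock[] //].
  by rewrite Cis e_irr in e_is.
have PM t i : 0 <= t < 1 -> i \in M -> P t i = (C i, t).
  by move=> t01 iM; rewrite /P iM min_l ?advance_stay //; case/andP: t01 => _ /ltW.
have PN t i : 0 <= t -> i \notin M -> P t i = (C i, 0).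
  by move=> t0 /negbTE iM; rewrite /P iM min_r ?advance_stay ?lexx ?ltr01.
have P1 i : i \in M -> P 1 i = (s, 0).
  by move=> iM; rewrite /P iM minxx advance_edge ?Me.
split.
- by split=> // i; case: (i \in M); rewrite ?lexx ?ler01.
- split; first by exists i0; rewrite P1.
  move=> t i t01; case: (boolP (i \in M)) => iM.
    by rewrite PM // => -[/Ces].
  by rewrite PN //; [case=> /Ces | case/andP: t01].
- move=> t i t01; have [t0 t1] := andP t01.
  case: (boolP (i \in M)) => iM.
    split; last by rewrite leNgt t1.
    move=> /existsP[j]; rewrite PM //.
    case: (boolP (j \in M)) => jM.
      rewrite PM // /on_path /=.
      case: (eqVneq (C j) (C i)) => [/Minj -> //|neq_ij].
        by rewrite eqxx ltnn andbF.
      rewrite (gdist_edge _ e_conn (Me _ iM)) // (gdist_edge _ e_conn (Me _ jM)) //.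
      by rewrite addn1 eqSS gdist_eq0 // eq_sym (negbTE neq_ij).
    rewrite PN // /on_path /=; have [Cjs [l lM]] := Mblock _ jM.
    (* A server outside [M] starting at the same vertex could obstruct only at [t = 0] and with a
       smaller index, but there the index in [M] is the smaller one. *)
    case: (eqVneq (C j) (C i)) => [eq_ji|neq_ji].
      rewrite eq_ji (gdist_edge _ e_conn (Me _ iM)) // (gdist_edge _ e_conn (Me _ lM)) //.
      rewrite addn1 eqSS gdist_eq0 // [C i == _]eq_sym andNb orbF.
      move=> /andP[/eqP /(Minj _ _ lM iM) <- ltij].
      move=> /andP[t_le0]; have -> : t = 0 by apply/le_anti; rewrite t0 t_le0.
      by rewrite eqxx /= ltnNge (ltnW ltij).
    rewrite (gdist_edge _ e_conn (Me _ iM)) //.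
    have : (0 < gdist e (C j) s)%N by rewrite lt0n gdist_eq0 //; apply/eqP.
    have : (0 < gdist e (C i) (C j))%N by rewrite lt0n gdist_eq0 // eq_sym.
    by case: (gdist e (C i) (C j)) (gdist e (C j) s) => [//|?] [//|?]; rewrite addSn addnS.
  split=> // _; have [Cis [j jM hj]] := Mblock _ iM.
  apply/existsP; exists j; rewrite PN // PM // /on_path /=.
  case: eqVneq hj => [->|neq_ji] /=; last first.
    by move=> ->; apply/orP; left; apply: contra neq_ji => /eqP[->].
  by rewrite orbF => ->; rewrite t0 orbT.
- move=> i; rewrite ffunE; case: ifPn => iM; first exact: P1.
  exact: PN.
- by rewrite -sum1_card natr_sum [RHS](bigID (mem M)) /= [X in _ + X]big1 ?addr0;
    [apply: eq_bigr => i -> | move=> i /negbTE ->].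
Qed.

Lemma codom_override C (M : seq 'I_k) (f : 'I_k -> V) L : uniq M ->
    perm_eq (codom C) (map C M ++ L) ->
  perm_eq (codom [ffun i => if i \in M then f i else C i]) (map f M ++ L).
Proof.
move=> M_uniq; set rest := [seq i <- enum 'I_k | i \notin M].
have enumE : perm_eq (enum 'I_k) (M ++ rest).
  apply: uniq_perm; first exact: enum_uniq.
    rewrite cat_uniq M_uniq (filter_uniq _ (enum_uniq _)) andbT /=.
    apply/hasPn => i; rewrite mem_filter => /andP[]; exact.
  by move=> i; rewrite mem_enum mem_cat mem_filter mem_enum andbT orbN.
have codomE (g : config V k) : perm_eq (codom g) (map g M ++ map g rest).
  by rewrite -map_cat; apply: perm_map.
rewrite (permPl (codomE C)) perm_cat2l => restL.
rewrite (permPl (codomE _)) perm_cat //.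
  suff -> : map [ffun i => if i \in M then f i else C i] M = map f M by [].
  by apply/eq_in_map => i iM; rewrite ffunE iM.
rewrite -(permPr restL) perm_sym.
suff -> : map [ffun i => if i \in M then f i else C i] rest = map C rest by [].
by apply/eq_in_map => i; rewrite mem_filter ffunE => /andP[/negbTE ->].
Qed.

Lemma relocate_codom C i y L :
  perm_eq (codom C) (C i :: L) -> perm_eq (codom (relocate C i y)) (y :: L).
Proof.
move=> CL; have := @codom_override C [:: i] (fun=> y) L isT CL.
suff -> : relocate C i y = [ffun j => if j \in [:: i] then y else C j] by [].
by apply/ffunP => j; rewrite !ffunE mem_seq1.
Qed.

Lemma mem_codom_perm C L x : perm_eq (codom C) L -> x \in L -> exists i, C i = x.
Proof. by move=> /perm_mem <- /codomP[i ->]; exists i. Qed.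

(** Passes from labelled servers to multisets of positions. [Z] may repeat points of [X]: the extra
    servers there lose the tie-break by index. *)
Lemma dc_star s C (X Z : seq V) :
    perm_eq (codom C) (X ++ Z) -> uniq X -> (0 < size X)%N ->
    {in X, forall x, e x s} ->
    {in Z, forall z, z != s /\
       exists2 x, x \in X & (gdist e z x + gdist e x s == gdist e z s)%N} ->
  exists C', dc_move e s C C' ((size X)%:R : R) /\
             perm_eq (codom C') (nseq (size X) s ++ Z).
Proof.
move=> CXZ X_uniq X_gt0 Xs Zblock.
(* At each point of [X], the server of least index. *)
pose M := [set i | (C i \in X) && [forall j, (C j == C i) ==> (i <= j)%N]].
have M_ex x : x \in X -> exists2 i, i \in M & C i = x /\ forall j, C j = x -> (i <= j)%N.
  move=> xX; have xL : x \in X ++ Z by rewrite mem_cat xX.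
  have [i0 Ci0] := mem_codom_perm CXZ xL.
  have i0P : C i0 == x by rewrite Ci0.
  case: (@arg_minnP _ i0 (fun i => C i == x) (fun i => i) i0P) => i /eqP Cix imin.
  exists i; last by split=> // j /eqP; exact: imin.
  by rewrite inE Cix xX; apply/forallP => j; apply/implyP; exact: imin.
have M_inj : {in M &, injective C}.
  move=> i j; rewrite !inE => /andP[_ /forallP/(_ j) imin] /andP[_ /forallP/(_ i) jmin] Cij.
  by apply/val_inj/eqP; rewrite eqn_leq (implyP imin) ?(implyP jmin) ?Cij.
have MX : perm_eq (map C (enum M)) X.
  apply: uniq_perm => // [|x].
    by rewrite map_inj_in_uniq ?enum_uniq // => i j; rewrite !mem_enum; exact: M_inj.
  apply/mapP/idP => [[i]|/M_ex[i iM [Cix _]]]; last by exists i; rewrite ?mem_enum.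
  by rewrite mem_enum inE => /andP[CiX _] ->.
have cardM : #|M| = size X by rewrite -(perm_size MX) size_map cardE.
exists [ffun i => if i \in M then s else C i]; split.
  have [i0 i0M] : exists i0, i0 \in M by apply/card_gt0P; rewrite cardM.
  rewrite -cardM; apply: (dc_move_star i0M) => // [i|i iM].
    by rewrite inE => /andP[/Xs].
  have : C i \in X ++ Z by rewrite -(perm_mem CXZ) codom_f.
  rewrite mem_cat; case: (boolP (C i \in X)) => /= CiX CiZ.
    split; first by move=> Cis; have := Xs _ CiX; rewrite Cis e_irr.
    have [j jM [Cji jmin]] := M_ex _ CiX; exists j => //.
    rewrite Cji eqxx /= orbF ltn_neqAle jmin // andbT.
    by apply: contraNneq iM => /val_inj <-.
  have [/eqP Cis [x xX dx]] := Zblock _ CiZ; split=> //.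
  have [j jM [Cjx _]] := M_ex _ xX; exists j => //; rewrite Cjx dx andbT.
  by apply/orP; right; apply: contraNneq CiX => <-.
have := @codom_override C (enum M) (fun=> s) Z (enum_uniq _).
rewrite (permPl CXZ) perm_cat2r perm_sym MX => /(_ isT).
rewrite (_ : map _ _ = nseq (size X) s); last first.
  by rewrite -cardM cardE; elim: (enum M) => //= ? ? ->.
suff -> : [ffun i => if i \in M then s else C i]
        = [ffun i => if i \in enum M then s else C i] by [].
by apply/ffunP => j; rewrite !ffunE mem_enum.
Qed.

End Moves.

(** Proves equality of multisets by counting an arbitrary predicate on both sides. *)
Ltac perm_count :=
  clear; apply/permP => ?; rewrite /= ?count_cat ?count_nseq /= ?count_cat ?count_nseq /=
    ?mulnS ?mulnDr ?mulnDl; lia.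

(** * Plays of double coverage against an offline algorithm *)

Section Game.
Variables (R : realType) (V : finType) (k : nat).
Implicit Types (move : V -> config V k -> config V k -> R -> Prop).
Implicit Types (D O L : seq V) (x y : R).

(** A [run] does not record its final configuration, so the effect of [sigma] is expressed through
    all continuations from [C']. Ranging over every [C] with positions [D] forgets server labels.
    One run is enough, since competitiveness bounds all runs. *)
Definition serves move D (sigma : seq (request V)) x D' :=
  forall C : config V k, perm_eq (codom C) D -> exists2 C' : config V k, perm_eq (codom C') D' &
  forall sigma' w, run move C' sigma' w -> run move C (sigma ++ sigma') (x + w).

Lemma serves_nil move D D' : perm_eq D D' -> serves move D [::] 0 D'.
Proof.
move=> DD' C CD; exists C; first by rewrite (permPl CD).
by move=> sigma w; rewrite add0r.
Qed.

Lemma serves_cat move D1 D2 D3 sigma1 sigma2 x1 x2 :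
    serves move D1 sigma1 x1 D2 -> serves move D2 sigma2 x2 D3 ->
  serves move D1 (sigma1 ++ sigma2) (x1 + x2) D3.
Proof.
move=> S1 S2 C1 /S1[C2 /S2[C3 C3D runS2] runS1]; exists C3 => // sigma w C3run.
by rewrite -catA -addrA; apply/runS1/runS2.
Qed.

Lemma serves_request move D s t x L :
    (forall C : config V k, perm_eq (codom C) D ->
       exists C' : config V k, move s C C' x /\ perm_eq (codom C') (s :: L)) ->
  serves move D [:: (s, t)] x (t :: L).
Proof.
move=> moveD C /moveD[C' [CC' C'L]].
have [i Ci] := mem_codom_perm C'L (mem_head _ _).
exists (relocate C' i t); first by apply: relocate_codom; rewrite Ci.
by move=> sigma w runC'; apply: run_cons CC' Ci runC'.
Qed.

Variable e : rel V.

Lemma serves_any b s t L :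
  serves (any_move e (k:=k)) (b :: L) [:: (s, t)] (gdist e b s)%:R (t :: L).
Proof.
apply: serves_request => C CbL; have [i Ci] := mem_codom_perm CbL (mem_head _ _).
exists (relocate C i s); split; last by apply: relocate_codom; rewrite Ci.
rewrite /any_move (bigD1 i) //= ffunE eqxx Ci big1 ?addn0 // => j /negbTE ji.
by rewrite ffunE ji gdistxx.
Qed.

(* Configurations are multisets of positions, given as lists up to permutation;
   [D], [x], [D'] belong to double coverage, [O], [y], [O'] to an offline
   algorithm serving the same requests. *)
Definition game D O x y D' O' :=
  exists sigma, serves (dc_move e (k:=k)) D sigma x D' /\ serves (any_move e (k:=k)) O sigma y O'.

Lemma game_perm D O D' O' : perm_eq D D' -> perm_eq O O' -> game D O 0 0 D' O'.
Proof. by move=> DD' OO'; exists [::]; split; exact: serves_nil. Qed.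

Lemma game_trans D1 O1 x1 y1 D2 O2 x2 y2 D3 O3 :
    game D1 O1 x1 y1 D2 O2 -> game D2 O2 x2 y2 D3 O3 ->
  game D1 O1 (x1 + x2) (y1 + y2) D3 O3.
Proof.
move=> [sigma1 [D12 O12]] [sigma2 [D23 O23]]; exists (sigma1 ++ sigma2).
by split; apply: serves_cat; eassumption.
Qed.

(** Builds a play forwards: a stage is matched up to the order of servers and its costs are
    subtracted from the goal, so that [game_end] leaves an identity of costs. *)
Lemma game_then D O x y D1 O1 x1 y1 D2 O2 D' O' :
    game D1 O1 x1 y1 D2 O2 -> perm_eq D D1 -> perm_eq O O1 ->
    game D2 O2 (x - x1) (y - y1) D' O' ->
  game D O x y D' O'.
Proof.
move=> G1 DD1 OO1 G2; have := game_trans (game_perm DD1 OO1) (game_trans G1 G2).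
by rewrite !add0r !(addrC _ (_ - _)) !subrK.
Qed.

Lemma game_end D O x y D' O' :
  x = 0 -> y = 0 -> perm_eq D D' -> perm_eq O O' -> game D O x y D' O'.
Proof. by move=> -> ->; apply: game_perm. Qed.

Lemma game_relocate1 a b D O : game (a :: D) (a :: O) 0 0 (b :: D) (b :: O).
Proof.
exists [:: (a, b)]; split; last by have := @serves_any a a b O; rewrite gdistxx.
apply: serves_request => C CaD; have [i Ci] := mem_codom_perm CaD (mem_head _ _).
by exists C; split; first exact: dc_move_occupied Ci.
Qed.

Lemma game_relocate L1 L2 D O : size L1 = size L2 ->
  game (L1 ++ D) (L1 ++ O) 0 0 (L2 ++ D) (L2 ++ O).
Proof.
elim: L1 L2 D O => [|a L1 IH] [|b L2] D O //=; first by move=> _; apply: game_perm.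
move=> [sizeL]; apply: (game_then (game_relocate1 a b (L1 ++ D) (L1 ++ O))) => //.
apply: (game_then (IH L2 (b :: D) (b :: O) sizeL)); try perm_count.
by apply: game_end; rewrite ?subr0 //; perm_count.
Qed.

Hypotheses (e_irr : irreflexive e) (e_conn : forall u v, connect e u v).

(** The request [(s, s)] has a trivial relocation; for [b = s] it is free offline. *)
Lemma game_request (X Z : seq V) b O s : uniq X -> (0 < size X)%N ->
    {in X, forall v, e v s} ->
    {in Z, forall z, z != s /\
       exists2 v, v \in X & (gdist e z v + gdist e v s == gdist e z s)%N} ->
  game (X ++ Z) (b :: O) (size X)%:R (gdist e b s)%:R
       (nseq (size X) s ++ Z) (s :: O).
Proof.
move=> X_uniq X_gt0 Xs Zblock; exists [:: (s, s)]; split; last exact: serves_any.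
have -> : nseq (size X) s = s :: nseq (size X).-1 s by case: (size X) X_gt0.
apply: serves_request => C CXZ.
have [C' [CC' C'XZ]] := dc_star R e_irr e_conn CXZ X_uniq X_gt0 Xs Zblock.
by exists C'; split=> //; rewrite (permPl C'XZ); case: (size X) X_gt0.
Qed.

End Game.

(** * The complete [K]-ary tree of depth [d] *)

Section Tree.
Variables d K : nat.

(* A vertex is the list of the steps leading to it from the root, last step first. *)
Definition vertex : finType := {bseq d of 'I_K}.
Implicit Types u v w s z : vertex.

Definition parent_of u v := (0 < size v)%N && (behead v == u :> seq 'I_K).

Definition tree_edge u v := parent_of u v || parent_of v u.

(** For a leaf [u] the list would be too long and the value is the root; hence the bounds
    [size u < d] below. *)
Definition child u (a : 'I_K) : vertex := insub_bseq d (a :: u).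

Lemma val_child u a : (size u < d)%N -> child u a = a :: u :> seq 'I_K.
Proof. by move=> ud; rewrite /child /insub_bseq /insubd insubT. Qed.

Lemma parent_ofP u v : reflect (exists a, v = a :: u :> seq 'I_K) (parent_of u v).
Proof.
apply: (iffP andP) => [[v0 /eqP vu]|[a ->]] //=.
by case: (bseqval v) v0 vu => // a l _ /= ->; exists a.
Qed.

Lemma parent_of_child u a : (size u < d)%N -> parent_of u (child u a).
Proof. by move=> ud; apply/parent_ofP; exists a; rewrite val_child. Qed.

Lemma child_inj u : (size u < d)%N -> injective (child u).
Proof.
by move=> ud a b /(congr1 (@bseqval _ _)); rewrite !val_child // => -[].
Qed.

Lemma size_parent_of u v : parent_of u v -> size v = (size u).+1.
Proof. by case/parent_ofP=> a ->. Qed.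

Lemma parent_of_uniq u u' v : parent_of u v -> parent_of u' v -> u = u'.
Proof. by case/andP=> _ /eqP vu /andP[_ /eqP vu']; apply: val_inj; rewrite /= -vu. Qed.

Lemma parent_ex v : (0 < size v)%N -> exists u, parent_of u v.
Proof.
move=> v0; have ud : (size (behead v) <= d)%N.
  by rewrite size_behead (leq_trans (leq_pred _)) ?size_bseq.
by exists (Bseq ud); rewrite /parent_of v0 /=.
Qed.

Lemma tree_edge_sym : symmetric tree_edge.
Proof. by move=> u v; rewrite /tree_edge orbC. Qed.

Lemma tree_edge_irr : irreflexive tree_edge.
Proof.
by move=> u; rewrite /tree_edge orbb; apply/negP => /size_parent_of; lia.
Qed.

Definition tree_root : vertex := [bseq].

Lemma path_to_root v : exists p, [/\ path tree_edge v p, last v p = tree_root & size p = size v].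
Proof.
move: {2}(size v) (erefl (size v)) => n; elim: n v => [|n IH] v sv.
  by exists [::]; split=> //; apply: val_inj; apply: size0nil.
have [|u uv] := @parent_ex v; first by rewrite sv.
have [|p [up pr sp]] := IH u.
  by apply/eqP; rewrite -eqSS -sv (size_parent_of uv).
exists (u :: p); split=> //=; last by rewrite sp (size_parent_of uv).
by rewrite /tree_edge uv orbT.
Qed.

Lemma tree_edge_conn u v : connect tree_edge u v.
Proof.
have to_root w : connect tree_edge w tree_root.
  by have [p [wp pr _]] := path_to_root w; apply/connectP; exists p.
apply: connect_trans (to_root u) _.
by rewrite (sym_connect_sym tree_edge_sym) to_root.
Qed.

(** Both cyclic neighbours of a deepest vertex of a cycle are its parent, so they coincide, which a
    cycle of length at least 3 forbids. *)
Lemma tree_is_tree : is_tree tree_edge.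
Proof.
split; [exact: tree_edge_sym|exact: tree_edge_irr|exact: tree_edge_conn|].
case=> [//|x0 p0]; set p := x0 :: p0 => p_cyc.
have x0p : x0 \in p := mem_head _ _.
case: (@arg_maxnP _ x0 (mem p) (fun v => size v) x0p) => w wp wmax.
have [i q rot_p] := rot_to wp.
have := p_cyc; rewrite -(rot_ucycle i) -(size_rot i p) rot_p => /andP[].
have up v : v \in q -> tree_edge w v -> parent_of v w.
  move=> vq /orP[/size_parent_of sv|//].
  have : v \in p by rewrite -(mem_rot i) rot_p inE vq orbT.
  by move/wmax; rewrite /= sv ltnn.
case: q rot_p up => [|a q] //= rot_p up.
case/lastP: q rot_p up => [|q z] //= rot_p up.
rewrite !rcons_path !last_rcons => /and3P[wa _ zw].
have -> : a = z.
  apply: (parent_of_uniq (v := w)); apply: up => //.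
  - by rewrite mem_head.
  - by rewrite inE mem_rcons mem_head orbT.
  - by rewrite tree_edge_sym.
by rewrite mem_rcons mem_head /= andbF.
Qed.

Lemma tree_has_depth : has_depth tree_edge d.
Proof.
exists tree_root => v; rewrite leqNgt; apply/negP.
have [p [vp pr sp]] := path_to_root v.
have := @gdist_path _ tree_edge tree_root (rev (belast v p)).
rewrite size_rev size_belast sp -pr rev_path.
rewrite (eq_path (e' := tree_edge)); last by move=> x y; rewrite tree_edge_sym.
have -> : last (last v p) (rev (belast v p)) = v.
  by case: (p) => //= a l; rewrite rev_cons last_rcons.
by move=> /(_ vp) le_v; have := size_bseq v; lia.
Qed.

(* The only way into the subtree of [s], whose vertices have [s] as a suffix,
   is the edge to [s] from its parent. *)
Lemma path_through_parent u s z p :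
    parent_of u s -> ~~ suffix s z -> path tree_edge z p -> last z p = s ->
  exists q, [/\ path tree_edge z q, last z q = u & (size q < size p)%N].
Proof.
move=> us; elim: p z => [|y p IH] z sz /=; first by move=> _ zs; rewrite zs suffix_refl in sz.
case/andP=> zy yp ys.
case: (boolP (suffix s y)) => [sy|/IH/(_ yp ys)[q [yq qu sq]]]; last first.
  by exists (y :: q); rewrite /= zy.
(* The step from [z] to [y] enters the subtree of [s]. It leads downwards, as an upward step would
   start inside; hence [y = s] and [z = u]. *)
exists [::]; split=> //=.
case/orP: zy => /[dup] par /parent_ofP[a ya]; last first.
  by case/negP: sz; rewrite ya; apply: suffix_trans sy (suffix_cons _ _).
have ys' : y = s.
  move: sy sz; rewrite ya; case/suffixP=> -[|b l] /= yl.
    by move=> _; apply: val_inj; rewrite /= ya.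
  by move: yl => [_ ->]; rewrite suffix_suffix.
by rewrite ys' in par; apply: parent_of_uniq par us.
Qed.

Lemma gdist_through_parent u s z : parent_of u s -> ~~ suffix s z ->
  (gdist tree_edge z u + gdist tree_edge u s == gdist tree_edge z s)%N.
Proof.
move=> us sz; have eus : tree_edge u s by rewrite /tree_edge us.
rewrite (gdist_edge tree_edge_irr tree_edge_conn eus) addn1 eqn_leq.
rewrite (gdist_rcons tree_edge_conn _ eus) andbT.
have [p [zp ps <-]] := gdist_attained (tree_edge_conn z s).
have [q [zq qu sq]] := path_through_parent us sz zp ps.
by apply: leq_ltn_trans sq; rewrite -qu gdist_path.
Qed.

(** The proper descendants of [u]. A server anywhere else reaches each child of [u] through [u]. *)
Definition strictly_below u z := suffix u z && (size u < size z)%N.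

Lemma strictly_below_child u s z :
  parent_of u s -> suffix s z -> strictly_below u z.
Proof.
move=> /[dup] us /parent_ofP[a sa] sz; apply/andP; split.
  by apply: suffix_trans _ sz; rewrite sa suffix_cons.
by rewrite -(size_parent_of us) size_suffix.
Qed.

Definition children u := [seq child u a | a <- enum 'I_K].

Lemma size_children u : size (children u) = K.
Proof. by rewrite size_map size_enum_ord. Qed.

Lemma children_uniq u : (size u < d)%N -> uniq (children u).
Proof. by move=> ud; rewrite map_inj_uniq ?enum_uniq //; apply: child_inj. Qed.

Lemma children_parent u : (size u < d)%N -> {in children u, forall v, parent_of u v}.
Proof. by move=> ud v /mapP[a _ ->]; apply: parent_of_child. Qed.

End Tree.

(** * The adversary: resolving the discrepancy downwards and carrying it upwards *)

Section Strategy.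
Variables (R : realType) (d K : nat).
Notation V := (vertex d K).
Notation E := (@tree_edge d K).
Notation game := (@game R V K E).
Implicit Types (u v w s z p c b : V) (D O L : seq V).

(** A server at [u] obstructs all of [D], including further servers at [u] itself, so only one
    leaves [u]. The offline server at [v] makes the request free. *)
Lemma game_pull u v L D O : parent_of u v -> uniq (u :: L) ->
    {in L, forall w, parent_of v w} -> {in D, forall z, ~~ strictly_below u z} ->
  game (u :: L ++ D) (v :: O) (size L).+1%:R 0 (nseq (size L).+1 v ++ D) (v :: O).
Proof.
move=> uv uL_uniq vL Du; have eE := @gdistxx V E v.
have := @game_request R V K E (@tree_edge_irr d K) (@tree_edge_conn d K)
  (u :: L) D v O v uL_uniq isT.
rewrite eE; apply=> [w|z /Du zu].
  by rewrite inE /tree_edge => /orP[/eqP ->|/vL ->]; rewrite ?uv ?orbT.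
have zv : ~~ suffix v z by apply: contra zu; apply: strictly_below_child.
split; last by exists u; rewrite ?mem_head ?gdist_through_parent.
by apply: contraNneq zv => ->; apply: suffix_refl.
Qed.

Lemma strictly_below_irr u : ~~ strictly_below u u.
Proof. by rewrite /strictly_below ltnn andbF. Qed.

Lemma strictly_below_parent u v z :
  parent_of u v -> strictly_below v z -> strictly_below u z.
Proof. by move=> uv /andP[vz _]; apply: strictly_below_child uv vz. Qed.

(* For the first child [v], the [q.+1] common servers are placed at children of
   [v] (at [u] if [v] is a leaf). The request at [v] attracts them together with
   exactly one server from [u]; then the same game is played one level below,
   at [v] with these children, while the rest of [D] stays obstructed. *)
Lemma game_down h u (Ch : seq V) q c D O :
    (size u + h.+1)%N = d -> (size Ch + q.+1 <= K)%N ->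
    uniq Ch -> {in Ch, forall v, parent_of u v} ->
    {in D, forall z, ~~ strictly_below u z} ->
  game (nseq (size Ch) u ++ nseq q.+1 c ++ D) (Ch ++ nseq q.+1 c ++ O)
       (2 * 'C(size Ch + q + h.+1, h.+1)%:R - 2 * 'C(q + h.+1, h.+1)%:R - (size Ch)%:R) 0
       (nseq (size Ch + q.+1) c ++ D) (nseq (size Ch + q.+1) c ++ O).
Proof.
(* Outer induction on the height, inner induction on the children still to be resolved; each
   resolved child adds one common server. *)
elim: h u Ch q D O => [|h IHh] u Ch q D O; elim: Ch q D O => [|v Ch IHCh] q D O ud.
1,3: by move=> *; rewrite /= add0n subrr subr0; exact: game_perm.
all: move=> sizeCh /= /andP[vCh Ch_uniq] up Du.
all: have uv : parent_of u v by apply: up; rewrite mem_head.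
all: have up' : {in Ch, forall w, parent_of u w} by move=> w wCh; apply: up; rewrite inE wCh orbT.
- have D'u : {in nseq (size Ch + q.+1) u ++ D, forall z, ~~ strictly_below u z}.
    move=> z; rewrite mem_cat mem_nseq => /orP[/andP[_ /eqP ->]|/Du //].
    exact: strictly_below_irr.
  apply: (game_then (@game_relocate R V K E (nseq q.+1 c) (nseq q.+1 u)
    (u :: nseq (size Ch) u ++ D) (v :: Ch ++ O) _)); rewrite ?size_nseq //; try perm_count.
  apply: (game_then (@game_pull u v [::] (nseq (size Ch + q.+1) u ++ D)
    (Ch ++ nseq q.+1 u ++ O) uv isT _ D'u)) => //; try perm_count.
  apply: (game_then (@game_relocate R V K E (v :: nseq q.+1 u) (nseq q.+2 c)
    (nseq (size Ch) u ++ D) (Ch ++ O) _)); rewrite /= ?size_nseq //; try perm_count.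
  apply: (game_then (IHCh q.+1 D O ud _ Ch_uniq up' Du)); try perm_count.
    by move: sizeCh => /=; lia.
  apply: game_end; try perm_count; last by rewrite !subr0.
  by rewrite !bin1 /=; ring.
- have vd : (size v + h.+1 = d)%N by rewrite (size_parent_of uv) addSnnS.
  have v_lt : (size v < d)%N by move: vd; lia.
  pose L := take q.+1 (children v).
  have sizeL : size L = q.+1.
    by rewrite size_takel // size_children; move: sizeCh => /=; lia.
  have vL : {in L, forall w, parent_of v w} by move=> w /mem_take; apply: children_parent.
  have L_uniq : uniq L by apply/take_uniq/children_uniq.
  have uL_uniq : uniq (u :: L).
    rewrite /= L_uniq andbT; apply/negP => /vL /size_parent_of.
    by rewrite (size_parent_of uv); lia.
  have D'u : {in nseq (size Ch) u ++ D, forall z, ~~ strictly_below u z}.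
    move=> z; rewrite mem_cat mem_nseq => /orP[/andP[_ /eqP ->]|/Du //].
    exact: strictly_below_irr.
  have D'v : {in nseq (size Ch) u ++ D, forall z, ~~ strictly_below v z}.
    by move=> z /D'u; apply: contra; apply: strictly_below_parent.
  apply: (game_then (@game_relocate R V K E (nseq q.+1 c) L
    (u :: nseq (size Ch) u ++ D) (v :: Ch ++ O) _)); rewrite ?size_nseq //; try perm_count.
  apply: (game_then (@game_pull u v L (nseq (size Ch) u ++ D)
    (L ++ Ch ++ O) uv uL_uniq vL D'u)); try perm_count.
  have Lv_size : (size L + 1 <= K)%N by rewrite sizeL; move: sizeCh => /=; lia.
  have G := IHh v L 0%N (nseq (size Ch) u ++ D) (Ch ++ O) vd Lv_size L_uniq vL D'v.
  rewrite sizeL in G *.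
  (* One server at [v] is now common; parked at [c], it is the single common server with which the
     play at [v] starts. *)
  have G1 := @game_relocate R V K E [:: v] [:: c]
    (nseq q.+1 v ++ nseq (size Ch) u ++ D) (L ++ Ch ++ O) erefl.
  apply: (game_then G1); try perm_count.
  apply: (game_then G); try perm_count.
  apply: (game_then (IHCh q.+1 D O ud _ Ch_uniq up' Du)); try perm_count.
    by move: sizeCh => /=; lia.
  apply: game_end; try perm_count; last by rewrite !subr0.
  have -> : ((size Ch).+1 + q + h.+2 = size Ch + q.+1 + h.+2)%N by lia.
  (* The pull and the play at [v] together cost [2 * 'C(q.+1 + h.+1, h.+1) - 1]; Pascal's rule turns
     this into the required increment. *)
  have -> : ('C(q.+1 + h.+2, h.+2) = 'C(q + h.+2, h.+2) + 'C(q.+1 + h.+1, h.+1))%N.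
    by rewrite addSn binS addSnnS.
  by rewrite /= addn0 add0n binn; ring.
Qed.

(* A fan keeps the parent: after the children it is the request that moves the
   servers on from [u], upwards. *)
Definition fan u L :=
  [/\ uniq L, {in L, forall v, E u v} &
      (0 < size u)%N -> exists2 p, parent_of p u & p \in L].

(** At the root, [L] consists of the [m.+1] siblings of [u]; elsewhere the parent of [p] takes the
    place of one sibling. *)
Lemma fan_ex m p u : K = m.+2 -> (size p < d)%N -> parent_of p u ->
  exists L, [/\ fan p (u :: L), size L = m.+1 & fan p L].
Proof.
move=> Km pd pu; pose L0 := rem u (children p).
have Epu : E p u by rewrite /tree_edge pu.
have u_child : u \in children p.
  case/parent_ofP: (pu) => a ua; apply/mapP; exists a; rewrite ?mem_enum //.
  by apply: val_inj; rewrite /= ua -val_child.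
have L0_uniq : uniq (u :: L0).
  by rewrite -(perm_uniq (perm_to_rem u_child)) children_uniq.
have L0p : {in L0, forall v, parent_of p v} by move=> v /mem_rem; apply: children_parent.
have sizeL0 : size L0 = m.+1 by rewrite size_rem // size_children Km.
have fan_cons L : fan p L -> u \notin L -> fan p (u :: L).
  move=> [L_uniq pL Lp] uL; split; first by rewrite /= uL.
    by move=> v; rewrite inE => /orP[/eqP ->|/pL].
  by move=> /Lp[q qp qL]; exists q; rewrite // inE qL orbT.
have [p0|p_root] := posnP (size p); last first.
  have [q qp] := parent_ex p_root; exists (q :: take m L0).
  have q_big v : parent_of p v -> q != v.
    move=> /size_parent_of pv; apply: contra_eqN (pv) => /eqP <-.
    by rewrite (size_parent_of qp); apply/negP => /eqP; lia.
  have F : fan p (q :: take m L0).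
    split; last by exists q; rewrite ?mem_head.
      case/andP: L0_uniq => _ L0_uniq; rewrite /= take_uniq // andbT.
      by apply/negP => /mem_take /L0p /q_big; rewrite eqxx.
    move=> v; rewrite inE => /orP[/eqP ->|/mem_take /L0p pv].
      by rewrite /tree_edge qp orbT.
    by rewrite /tree_edge pv.
  split=> //; last by rewrite /= size_takel // sizeL0.
  apply: fan_cons => //; rewrite inE negb_or eq_sym q_big //=.
  by apply: contra (proj1 (andP L0_uniq)); apply: mem_take.
exists L0; have F : fan p L0.
  split; rewrite ?p0 //; first by case/andP: L0_uniq.
  by move=> v /L0p pv; rewrite /tree_edge pv.
by split=> //; apply: fan_cons => //; case/andP: L0_uniq.
Qed.

Lemma game_gather p L b O : (0 < size L)%N -> uniq L -> {in L, forall v, E p v} ->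
  game L (b :: O) (size L)%:R (gdist E b p)%:R (nseq (size L) p) (p :: O).
Proof.
move=> L0 L_uniq Lp.
have := @game_request R V K E (@tree_edge_irr d K) (@tree_edge_conn d K)
  L [::] b O p L_uniq L0.
by rewrite !cats0; apply=> // v /Lp; rewrite tree_edge_sym.
Qed.

(* Once the children in [L] have been requested by [game_down], only the parent
   [p] is left; the common servers are spread over the other neighbours of [p],
   so that the request at [p] attracts all servers, and [p] takes the role of
   [u]. *)
Lemma game_up m u L c : K = m.+2 -> (size u < d)%N -> fan u L -> size L = m.+1 ->
  game (nseq m.+1 u ++ [:: c]) (L ++ [:: c])
       (2 * (\sum_(d - size u <= h < d) 'C(m + h, h))%N%:R + 2 * 'C(m.+1 + d, d)%:R
        - m.+3%:R) 0
       (nseq m.+2 c) (nseq m.+2 c).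
Proof.
move=> Km; move: {2}(size u) (erefl (size u)) => n.
elim: n u L => [|n IH] u L un ud [L_uniq uL Lp] sizeL.
  have uCh : {in L, forall v, parent_of u v}.
    by move=> v /uL /orP[//|/size_parent_of]; rewrite un.
  have d0 : (size u + d.-1.+1)%N = d by lia.
  have LK : (size L + 1 <= K)%N by rewrite sizeL Km addn1.
  have := @game_down d.-1 u L 0%N c [::] [::] d0 LK L_uniq uCh.
  rewrite sizeL !cats0 addn1 => G.
  apply: (game_then (G _)) => //; apply: game_end; rewrite ?subrr // un subn0.
  rewrite big_geq // addn0 add0n binn prednK; last by lia.
  by ring.
have [|p pu pL] := Lp; first by rewrite un.
have pn : size p = n by apply/eqP; rewrite -eqSS -un (size_parent_of pu).
have perm_L := perm_to_rem pL; set Ch := rem p L in perm_L.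
have sizeCh : size Ch = m by rewrite size_rem // sizeL.
have /andP[pCh Ch_uniq] : uniq (p :: Ch) by rewrite -(perm_uniq perm_L).
have uCh : {in Ch, forall v, parent_of u v}.
  move=> v vCh; have /uL /orP[//|vu] : v \in L by apply: mem_rem vCh.
  by move: pCh; rewrite (parent_of_uniq pu vu) vCh.
have [N [fan_uN sizeN fanN]] : exists N, [/\ fan p (u :: N), size N = m.+1 & fan p N].
  by apply: fan_ex; rewrite // pn -ltnS -un ltnW.
have [uN_uniq pN _] := fan_uN; have [h hd] : exists h, (n.+1 + h.+1)%N = d.
  by exists (d - n.+2)%N; move: ud; rewrite un; lia.
have LK : (size Ch + 1 <= K)%N by rewrite sizeCh Km addn1.
have Du : {in [:: u], forall z, ~~ strictly_below u z}.
  by move=> z; rewrite inE => /eqP ->; apply: strictly_below_irr.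
(* Of the [m.+1] servers at [u], only [m] are matched with children; the last one stays, against the
   offline server at [p]. *)
have G1 := @game_down h u Ch 0%N c [:: u] [:: p] _ LK Ch_uniq uCh Du.
rewrite un sizeCh addn1 in G1; apply: (game_then (G1 hd)); first by perm_count.
  by apply: (perm_trans (y := (p :: Ch) ++ [:: c])); [rewrite perm_cat2r|perm_count].
apply: (game_then (@game_relocate R V K E (nseq m.+1 c) N [:: u] [:: p] _)) => //.
  by rewrite size_nseq sizeN.
apply: (game_then (@game_gather p (u :: N) p N isT uN_uniq pN)); try perm_count.
rewrite gdistxx /= sizeN.
apply: (game_then (@game_relocate1 R V K E p c (nseq m.+1 p) N)) => //.
apply: (game_then (IH p N pn _ fanN sizeN)); try perm_count.
  by rewrite pn -ltnS -un ltnW.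
apply: game_end => //; last by rewrite !subr0.
(* The gathering cost [m.+2] cancels the negative terms of [game_down], so a level at height [h.+1]
   contributes exactly [2 * 'C(m + h.+1, h.+1)]. *)
rewrite un pn [in X in 2 * X]big_ltn; last by lia.
have -> : (d - n.+1 = h.+1)%N by lia.
have -> : (d - n = h.+2)%N by lia.
by rewrite addn0 add0n binn; ring.
Qed.

End Strategy.

(** * The cost of a full phase, and its unbounded repetition *)

Lemma sum_bin_diag m d : (\sum_(0 <= h < d.+1) 'C(m + h, h) = 'C(m.+1 + d, d))%N.
Proof.
elim: d => [|d IH]; first by rewrite big_nat1 !bin0.
by rewrite big_nat_recr //= IH addSnnS [in RHS]addSn binS addnC.
Qed.

Lemma game_phase (R : realType) k d (c : vertex d k) : (1 <= k)%N -> (1 <= d)%N ->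
  game k (@tree_edge d k) (nseq k c) (nseq k c)
    (4 * \sum_(1 <= h < d) 'C(k + h - 2, h) + 2 * 'C(k + d - 2, d) + 1)%N%:R
    (1 : R) (nseq k c) (nseq k c).
Proof.
move=> k1 d1; pose a : 'I_k := Ordinal k1.
have size_u0 : (size (nseq d.-1 a) <= d)%N by rewrite size_nseq leq_pred.
pose u0 : vertex d k := Bseq size_u0; have u0d : (size u0 < d)%N by rewrite size_nseq prednK.
have bu0 := parent_of_child a u0d; set b := child u0 a in bu0.
have Ebu : tree_edge b u0 by rewrite /tree_edge bu0 orbT.
have Eub : tree_edge u0 b by rewrite /tree_edge bu0.
have db : gdist (@tree_edge d k) b u0 = 1%N.
  exact: (gdist_edge (@tree_edge_irr d k) (@tree_edge_conn d k) Ebu).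
(* For [k = 1] all binomials vanish, and one edge travelled by both sides gives ratio 1. *)
case: (ltnP 1 k) => [k2|k_le1]; last first.
  have kE : k = 1%N by lia.
  have -> : nseq k c = [:: c] by rewrite [X in nseq X _]kE.
  apply: (game_then (@game_relocate1 R _ k (@tree_edge d k) c b [::] [::])) => //.
  apply: (game_then (@game_gather R d k u0 [:: b] b [::] isT isT _)) => //.
    by move=> v; rewrite inE => /eqP ->.
  apply: (game_then (@game_relocate1 R _ k (@tree_edge d k) u0 c [::] [::])) => //.
  apply: game_end => //; last by rewrite db; ring.
  rewrite big_nat_cond big1 => [|h /andP[h1 _]].
    by rewrite bin_small ?kE /=; [ring|lia].
  by rewrite bin_small ?kE //; lia.
have [m km] : exists m, k = m.+2 by exists k.-2; lia.
have [L [[bL_uniq bL _] sizeL fanL]] := fan_ex km u0d bu0.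
have sizebL : size (b :: L) = k by rewrite /= sizeL km.
apply: (game_then (@game_relocate R _ k (@tree_edge d k) (nseq k c) (b :: L) [::] [::] _)).
- by rewrite size_nseq sizebL.
- by rewrite cats0.
- by rewrite cats0.
rewrite !cats0.
(* The only offline expense of the phase: one step from [b] to [u0], while double coverage pays
   [k]. *)
apply: (game_then (@game_gather R d k u0 (b :: L) b L isT bL_uniq bL)) => //.
have nseq_k x : perm_eq (nseq k x) (nseq m.+2 x) by rewrite [X in nseq X _]km.
rewrite sizebL db.
apply: (game_then (@game_relocate1 R _ k (@tree_edge d k) u0 c (nseq m.+1 u0) L)) => //.
apply: (game_then (@game_up R d k m u0 L c km u0d fanL sizeL)); try perm_count.
apply: game_end; [|by ring|by rewrite perm_sym|by rewrite perm_sym].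
have -> : (d - size u0 = 1)%N by rewrite size_nseq; lia.
(* The hockey-stick identity yields a second copy of the sum over levels, hence the coefficient 4;
   its term for [h = 0] is the 1 split off. *)
have -> : 'C(m.+1 + d, d) = (1 + \sum_(1 <= h < d) 'C(m + h, h) + 'C(m + d, d))%N.
  by rewrite -sum_bin_diag big_nat_recr //= big_ltn // bin0.
have -> : (\sum_(1 <= h < d) 'C(k + h - 2, h) = \sum_(1 <= h < d) 'C(m + h, h))%N.
  by apply: eq_bigr => h _; congr 'C(_, _); lia.
have -> : (k + d - 2 = m + d)%N by lia.
have -> : k%:R = m.+2%:R :> R by rewrite km.
by ring.
Qed.

Lemma game_repeat (R : realType) (V : finType) k (e : rel V) D O (x y : R) n :
  game k e D O x y D O -> game k e D O (n%:R * x) (n%:R * y) D O.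
Proof.
move=> G; elim: n => [|n IH]; first by rewrite !mul0r; apply: game_perm.
by rewrite -!natr1 !mulrDl !mul1r; apply: game_trans IH G.
Qed.

Lemma run_any_ge0 (R : realType) (V : finType) k (e : rel V) (C : config V k) sigma (v : R) :
  run (any_move e (k:=k)) C sigma v -> 0 <= v.
Proof.
by elim=> // {}C s y {}sigma C' w i w' -> _ _ w'0; rewrite addr_ge0.
Qed.

Lemma opt_bounds (R : realType) (V : finType) k (e : rel V) (C : config V k) sigma (v : R) :
  run (any_move e (k:=k)) C sigma v -> 0 <= opt R e C sigma <= v.
Proof.
move=> Cv; apply/andP; split.
  by apply: lb_le_inf; [exists v | move=> w; apply: run_any_ge0].
by apply: ge_inf => //; exists 0 => w; apply: run_any_ge0.
Qed.

(** Each phase costs [x] against 1 offline and restores the positions, so after [n] phases the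
    excess outgrows any fixed [a]. *)
Lemma not_competitive (R : realType) (V : finType) k (e : rel V) (cls : metric_class)
    (C : config V k) (x c' : R) :
    cls V e -> 0 < x -> c' < x ->
    game k e (codom C) (codom C) x 1 (codom C) (codom C) ->
  ~ competitive cls (fun V e => @double_coverage R V e k) c'.
Proof.
move=> Ve x0 c'x G /(_ V e Ve C)[a bound].
(* [c'] may be negative; a nonnegative factor is needed to replace [opt] by its upper bound [n]. *)
pose c := Num.max c' 0; have cx : 0 < x - c by rewrite subr_gt0 gt_max c'x.
have le_a n : n%:R * (x - c) <= a.
  have [sigma [dc any]] := game_repeat n G.
  have [C1 _ /(_ [::] 0 (run_nil _ _))] := dc C (perm_refl _).
  have [C2 _ /(_ [::] 0 (run_nil _ _))] := any C (perm_refl _).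
  rewrite cats0 !addr0 mulr1 => /opt_bounds/andP[opt0 optn] /bound.
  rewrite mulrBr lerBlDr => /le_trans; apply; rewrite addrC lerD2l [n%:R * c]mulrC.
  apply: (le_trans (y := c * opt R e C sigma)); first by rewrite ler_wpM2r // /c le_max lexx.
  by rewrite ler_wpM2l // /c le_max lexx orbT.
have := le_a (Num.bound (a / (x - c))).
rewrite leNgt -ltr_pdivrMr // => /negP; apply.
by apply: archi_boundP; rewrite divr_ge0 ?(ltW cx) //; have := le_a 0%N; rewrite mul0r.
Qed.

Theorem theorem13 (R : realType) (k d : nat) (hk : (1 <= k)%N) (hd : (1 <= d)%N) :
  ratio_at_least (tree_metrics d) (fun V e => @double_coverage R V e k)
    (4 * \sum_(1 <= h < d) 'C(k + h - 2, h) + 2 * 'C(k + d - 2, d) + 1)%N%:R.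
Proof.
move=> c' c'F; pose C : config (vertex d k) k := [ffun=> tree_root d k].
have CE : codom C = nseq k (tree_root d k).
  have /all_pred1P -> : all (pred1 (tree_root d k)) (codom C).
    by apply/allP => _ /codomP[i ->]; rewrite /= ffunE.
  by rewrite size_codom card_ord.
apply: (@not_competitive R _ k (@tree_edge d k) _ C _ _ _ _ c'F).
- by split; [exact: tree_is_tree | exact: tree_has_depth].
- by rewrite ltr0n addn1.
- by rewrite CE; apply: game_phase.
Qed.
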